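(* The general column generation (GCG) algorithm described in the context terminates after finitely many iterations, and the value $Z^{UB}$ it returns satisfies $$Z^{IP}\le Z^{UB}\le Z^{LIN}.$$
   Context: Let $c\in\mathbb{R}^n$, $d\in\mathbb{R}^m$, let $A,H,G$ be real matrices and $b,h$ real vectors of compatible dimensions, where $Az\le b$ includes the bounds $0\le z\le 1$, and the variables $u\in\mathbb{R}^m$ are free. Let $P=\{z\in\{0,1\}^n : Az\le b\}$, assumed nonempty, and let $\operatorname{lin}(P)$ be the linear subspace spanned by $P$. Let $$Z^{IP}=\max\{c'z+d'u : Az\le b,\ Hz+Gu\le h,\ z\in\{0,1\}^n\},$$ $$Z^{LIN}=\max\{c'z+d'u : Az\le b,\ Hz+Gu\le h,\ z\in\operatorname{lin}(P)\}.$$ Assume the problem defining $Z^{LIN}$ is feasible with finite optimal value. For a matrix $V$ with $n$ rows, the restricted master problem is the linear program $$Z(V)=\max\{c'V\lambda+d'u : AV\lambda\le b,\ HV\lambda+Gu\le h\}$$ with $\lambda,u$ free, and dual row vectors $\alpha\ge 0$ (for $AV\lambda\le b$) and $\pi\ge0$ (for $HV\lambda+Gu\le h$). For a row vector $\pi$, the pricing problem is $$L(\pi)=\max\{c'v-\pi(Hv-h) : Av\le b,\ v\in\{0,1\}^n\}.$$ GCG algorithm. Start with a matrix $V^1$ whose columns are linearly independent, lie in $\operatorname{lin}(P)$, and whose column span contains the $z$-part of at least one feasible solution of the problem defining $Z^{LIN}$. At iteration $k\ge1$: (1) Solve the restricted master problem with $V=V^k$, obtaining $Z^L_k=Z(V^k)$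 and an optimal dual solution $(\alpha^k,\pi^k)$. (2) Solve the pricing problem with $\pi=\pi^k$, obtaining $L(\pi^k)$ and an optimal solution $\hat v$; set $Z^U_k=\min\{L(\pi^i): i=1,\dots,k\}$. (3) If $Z^U_k\le Z^L_k$, stop and return $Z^{UB}=Z^U_k$. Otherwise set $V^{k+1}=[V^k,\hat v]$ (append the column $\hat v$) and go to iteration $k+1$. *)

(* Defs.v *)
From Stdlib Require Export Relation_Operators.
From mathcomp Require Export all_boot all_order all_algebra.
From mathcomp Require Export classical_sets reals constructive_ereal ereal.
Export Order.TTheory GRing.Theory Num.Theory.

Set Implicit Arguments.
Unset Strict Implicit.
Unset Printing Implicit Defensive.

#[export] Set Implicit Arguments.

Global Open Scope classical_set_scope.
Global Open Scope ring_scope.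

(* The optimal value of "max f over S" lives in the extended reals: it is
   -oo when S is empty and +oo when f is unbounded on S. *)
Definition max_value (R : realType) (T : Type) (S : set T) (f : T -> R) : \bar R :=
  ereal_sup [set (f x)%:E | x in S].

Definition is_maximizer (R : realType) (T : Type) (S : set T) (f : T -> R) (x : T) :
  Prop := S x /\ forall y, S y -> f y <= f x.

Definition is_minimizer (R : realType) (T : Type) (S : set T) (f : T -> R) (x : T) :
  Prop := S x /\ forall y, S y -> f x <= f y.

Definition mx_le (R : realType) (m n : nat) (X Y : 'M[R]_(m, n)) : Prop :=
  forall i j, X i j <= Y i j.

Definition dot (R : realType) (k : nat) (x : 'rV[R]_k) (y : 'cV[R]_k) : R :=
  (x *m y) 0 0.

Definition linear_span (R : realType) (n : nat) (S : set 'cV[R]_n) : set 'cV[R]_n :=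
  [set z | exists2 X : seq 'cV[R]_n, {in X, forall x, S x} & z \in <<X>>%VS].

Definition binary (R : realType) (n : nat) (z : 'cV[R]_n) : Prop :=
  forall i, z i 0 = 0 \/ z i 0 = 1.

(* n entries of z, m entries of u, p rows of A, q rows of H and G *)
Record gcg_data (R : realType) (n m p q : nat) := GcgData {
  gc : 'cV[R]_n;
  gd : 'cV[R]_m;
  gA : 'M[R]_(p, n);
  gb : 'cV[R]_p;
  gH : 'M[R]_(q, n);
  gG : 'M[R]_(q, m);
  gh : 'cV[R]_q }.

Section Problems.
Variables (R : realType) (n m p q : nat) (D : gcg_data R n m p q).

Local Notation c := (gc D).
Local Notation d := (gd D).
Local Notation A := (gA D).
Local Notation b := (gb D).
Local Notation H := (gH D).
Local Notation G := (gG D).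
Local Notation h := (gh D).

(* The inequalities z_j <= 1 and - z_j <= 0 are among the rows of A z <= b. *)
Definition includes_unit_bounds : Prop :=
  forall j : 'I_n,
    (exists i, row i A = delta_mx 0 j /\ b i 0 = 1) /\
    (exists i, row i A = - delta_mx 0 j /\ b i 0 = 0).

Definition gcgP : set 'cV[R]_n := [set z | binary z /\ mx_le (A *m z) b].

Definition objective (zu : 'cV[R]_n * 'cV[R]_m) : R :=
  dot c^T zu.1 + dot d^T zu.2.

Definition ip_feasible : set ('cV[R]_n * 'cV[R]_m) :=
  [set zu | [/\ mx_le (A *m zu.1) b,
                mx_le (H *m zu.1 + G *m zu.2) h & binary zu.1]].

Definition lin_feasible : set ('cV[R]_n * 'cV[R]_m) :=
  [set zu | [/\ mx_le (A *m zu.1) b,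
                mx_le (H *m zu.1 + G *m zu.2) h & linear_span gcgP zu.1]].

Definition Z_IP : \bar R := max_value ip_feasible objective.

Definition Z_LIN : \bar R := max_value lin_feasible objective.

Section RestrictedMaster.
Variables (r : nat) (V : 'M[R]_(n, r)).

Definition master_feasible : set ('cV[R]_r * 'cV[R]_m) :=
  [set lu | mx_le (A *m V *m lu.1) b /\ mx_le (H *m V *m lu.1 + G *m lu.2) h].

Definition master_objective (lu : 'cV[R]_r * 'cV[R]_m) : R :=
  dot (c^T *m V) lu.1 + dot d^T lu.2.

Definition master_value : \bar R := max_value master_feasible master_objective.

(* LP dual; the constraints are equations because lambda and u are free. *)
Definition master_dual_feasible : set ('rV[R]_p * 'rV[R]_q) :=
  [set ap | [/\ mx_le 0 ap.1, mx_le 0 ap.2,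
                ap.1 *m A *m V + ap.2 *m H *m V = c^T *m V
              & ap.2 *m G = d^T]].

Definition master_dual_objective (ap : 'rV[R]_p * 'rV[R]_q) : R :=
  dot ap.1 b + dot ap.2 h.

Definition master_solution (lambda : 'cV[R]_r) (u : 'cV[R]_m)
    (alpha : 'rV[R]_p) (pi : 'rV[R]_q) : Prop :=
  is_maximizer master_feasible master_objective (lambda, u) /\
  is_minimizer master_dual_feasible master_dual_objective (alpha, pi).

End RestrictedMaster.

Definition pricing_objective (pi : 'rV[R]_q) (v : 'cV[R]_n) : R :=
  dot c^T v - dot pi (H *m v - h).

Definition pricing_value (pi : 'rV[R]_q) : \bar R :=
  max_value gcgP (pricing_objective pi).

Definition upper_bound (pis : seq 'rV[R]_q) : \bar R :=
  \big[mine/+oo%E]_(pi <- pis) pricing_value pi.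

(* [Running V pis] is the state at the start of an iteration: the current
   matrix and the dual vectors pi of all earlier iterations. *)
Inductive gcg_state : Type :=
  | Running (r : nat) (V : 'M[R]_(n, r)) (pis : seq 'rV[R]_q)
  | Returned (ZUB : \bar R).

(* One iteration; the relation is nondeterministic because any optimal
   solutions of the two subproblems may be used. *)
Inductive gcg_step : gcg_state -> gcg_state -> Prop :=
  | gcg_stop (r : nat) (V : 'M[R]_(n, r)) (pis : seq 'rV[R]_q)
      (lambda : 'cV[R]_r) (u : 'cV[R]_m) (alpha : 'rV[R]_p) (pi : 'rV[R]_q)
      (v : 'cV[R]_n) :
      master_solution V lambda u alpha pi ->
      is_maximizer gcgP (pricing_objective pi) v ->
      (upper_bound (rcons pis pi) <= master_value V)%E ->
      gcg_step (Running V pis) (Returned (upper_bound (rcons pis pi)))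
  | gcg_continue (r : nat) (V : 'M[R]_(n, r)) (pis : seq 'rV[R]_q)
      (lambda : 'cV[R]_r) (u : 'cV[R]_m) (alpha : 'rV[R]_p) (pi : 'rV[R]_q)
      (v : 'cV[R]_n) :
      master_solution V lambda u alpha pi ->
      is_maximizer gcgP (pricing_objective pi) v ->
      ~ (upper_bound (rcons pis pi) <= master_value V)%E ->
      gcg_step (Running V pis) (Running (row_mx V v) (rcons pis pi)).

Definition gcg_reachable : gcg_state -> gcg_state -> Prop :=
  clos_refl_trans_n1 gcg_state gcg_step.

Definition initial_matrix (r : nat) (V : 'M[R]_(n, r)) : Prop :=
  [/\ free [seq col j V | j : 'I_r],
      forall j, linear_span gcgP (col j V)
    & exists (lambda : 'cV[R]_r) (u : 'cV[R]_m), lin_feasible (V *m lambda, u)].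

End Problems.

Arguments Running {R n q r} V pis.
Arguments Returned {R n q} ZUB.

(* Main.v *)
From mathcomp Require Import boolp lra.
Require Import Defs.

Unset Strict Implicit.
Unset Printing Implicit Defensive.

(** The whole argument is linear programming duality applied to the restricted
    master problem, together with a rank count.

    Let (alpha, pi) be optimal for the dual of the master problem with matrix V.

    - If a column v of P lies in the column span of V, then the dual equation
      alpha A V + pi H V = c' V gives
      c' v - pi (H v - h) = alpha A v + pi h <= alpha b + pi h,
      and by strong duality the right-hand side is Z(V)
      ([pricing_objective_span]).  So when the maximizer v of the pricing
      problem lies in that span, L(pi) <= Z(V) and the algorithm stops.  An
      iteration that continues therefore appends a column outside the span and
      raises the rank of V ([gcg_step_progress]); the rank is at most n, hence
      every execution is finite ([gcg_terminates]).

    - Every pi met on the way satisfies pi >= 0 and pi G = d', so relaxing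
      H z + G u <= h with multipliers pi shows Z^IP <= L(pi)
      ([Z_IP_le_pricing_value]).  The columns of V stay in lin(P), so the master
      problem is a restriction of the problem defining Z^LIN and
      Z(V) <= Z^LIN ([master_value_le_Z_LIN]).  On stopping,
      Z^IP <= Z^U <= Z(V) <= Z^LIN.

    - The master problem stays feasible because the columns of V^1 are kept,
      and it is bounded by Z^LIN; so it has optimal primal and dual solutions
      ([master_solution_exists]).  The pricing problem is over a nonempty finite
      set.  Hence no iteration gets stuck ([gcg_step_exists]).

    The duality theorem used, with attainment on both sides, is
    [strong_duality]; it is derived from Farkas' lemma, proved by induction on
    the number of inequalities. *)

(** * Componentwise order on matrices and the dot product *)

Section MatrixOrder.
Variable R : realType.

Lemma mx_le_col_mx p q k (X1 Y1 : 'M[R]_(p, k)) (X2 Y2 : 'M[R]_(q, k)) :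
  mx_le (col_mx X1 X2) (col_mx Y1 Y2) <-> mx_le X1 Y1 /\ mx_le X2 Y2.
Proof.
split=> [H | [H1 H2] i j].
  by split=> i j; [have := H (lshift q i) j | have := H (rshift p i) j];
    rewrite ?col_mxEu ?col_mxEd.
by rewrite -(splitK i); case: (split i) => i' /=; rewrite ?col_mxEu ?col_mxEd.
Qed.

Lemma mx_le_col_mx0 p q k (X1 : 'M[R]_(p, k)) (X2 : 'M[R]_(q, k)) :
  mx_le (col_mx X1 X2) 0 <-> mx_le X1 0 /\ mx_le X2 0.
Proof. by rewrite -mx_le_col_mx col_mx0. Qed.

Lemma mx_le0_row_mx p q k (X1 : 'M[R]_(k, p)) (X2 : 'M[R]_(k, q)) :
  mx_le 0 (row_mx X1 X2) <-> mx_le 0 X1 /\ mx_le 0 X2.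
Proof.
split=> [H | [H1 H2] i j].
  split=> i j; [have := H i (lshift q j) | have := H i (rshift p j)];
    by rewrite ?row_mxEl ?row_mxEr !mxE.
rewrite -(splitK j) [leLHS]mxE; case: (split j) => j' /=.
  by have := H1 i j'; rewrite row_mxEl mxE.
by have := H2 i j'; rewrite row_mxEr mxE.
Qed.

Lemma mx_le_mul2l k p r (Y : 'M[R]_(k, p)) (X1 X2 : 'M[R]_(p, r)) :
  mx_le 0 Y -> mx_le X1 X2 -> mx_le (Y *m X1) (Y *m X2).
Proof.
move=> Y0 X12 i j; rewrite !mxE; apply: ler_sum => l _.
by apply: ler_wpM2l (X12 l j); have := Y0 i l; rewrite mxE.
Qed.

Lemma mx_leZ p k (a : R) (X1 X2 : 'M[R]_(p, k)) :
  0 <= a -> mx_le X1 X2 -> mx_le (a *: X1) (a *: X2).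
Proof. by move=> a0 X12 i j; rewrite !mxE; apply: ler_wpM2l. Qed.

Lemma mx_le_scale p k (M : 'M[R]_(p, k)) (b : 'cV[R]_p) (t : R) (x : 'cV[R]_k) :
  0 < t -> mx_le (M *m x) (t *: b) -> mx_le (M *m (t^-1 *: x)) b.
Proof.
move=> t0 Mx i j; rewrite -scalemxAr [leLHS]mxE ler_pdivrMl //.
by have := Mx i j; rewrite [leRHS]mxE.
Qed.

Lemma mx_leB0 p k (X1 X2 : 'M[R]_(p, k)) : mx_le (X1 - X2) 0 <-> mx_le X1 X2.
Proof. by split=> H i j; have := H i j; rewrite !mxE subr_le0. Qed.

Lemma dotZr k (x : 'rV[R]_k) (a : R) (y : 'cV[R]_k) :
  dot x (a *: y) = a * dot x y.
Proof. by rewrite /dot -scalemxAr mxE. Qed.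

Lemma dotDr k (x : 'rV[R]_k) (y1 y2 : 'cV[R]_k) :
  dot x (y1 + y2) = dot x y1 + dot x y2.
Proof. by rewrite /dot mulmxDr mxE. Qed.

Lemma dotNr k (x : 'rV[R]_k) (y : 'cV[R]_k) : dot x (- y) = - dot x y.
Proof. by rewrite /dot mulmxN mxE. Qed.

Lemma dotZl k (x : 'rV[R]_k) (a : R) (y : 'cV[R]_k) :
  dot (a *: x) y = a * dot x y.
Proof. by rewrite /dot -scalemxAl mxE. Qed.

Lemma dotDl k (x1 x2 : 'rV[R]_k) (y : 'cV[R]_k) :
  dot (x1 + x2) y = dot x1 y + dot x2 y.
Proof. by rewrite /dot mulmxDl mxE. Qed.

Lemma dotNl k (x : 'rV[R]_k) (y : 'cV[R]_k) : dot (- x) y = - dot x y.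
Proof. by rewrite /dot mulNmx mxE. Qed.

Lemma dot0l k (y : 'cV[R]_k) : dot 0 y = 0.
Proof. by rewrite /dot mul0mx mxE. Qed.

Lemma dot_mulmx k l (x : 'rV[R]_k) (M : 'M[R]_(k, l)) (y : 'cV[R]_l) :
  dot (x *m M) y = dot x (M *m y).
Proof. by rewrite /dot mulmxA. Qed.

Lemma dot_row_col k l (x1 : 'rV[R]_k) (x2 : 'rV[R]_l) y1 y2 :
  dot (row_mx x1 x2) (col_mx y1 y2) = dot x1 y1 + dot x2 y2.
Proof. by rewrite /dot mul_row_col mxE. Qed.

Lemma scalar11 (a : R) : (a%:M : 'M_1) 0 0 = a.
Proof. by rewrite mxE eqxx mulr1n. Qed.

Lemma dot_scalar (a t : R) : dot (a%:M : 'M_1) t%:M = a * t.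
Proof. by rewrite /dot -scalar_mxM scalar11. Qed.

Lemma ler_dot k (y : 'rV[R]_k) (x1 x2 : 'cV[R]_k) :
  mx_le 0 y -> mx_le x1 x2 -> dot y x1 <= dot y x2.
Proof. by move=> y0 x12; apply: mx_le_mul2l. Qed.

End MatrixOrder.

(** * Farkas' lemma and linear programming duality *)

Section LinearProgramming.
Variable R : realType.

(** Induction on the rows, with col_mx a N as the matrix.  If N alone does not
    imply c x <= 0, some x1 has N x1 <= 0 < c x1, and then a x1 > 0, so a x1 = 1
    after scaling.  The map x |-> x - x1 (a x) sends every x into the hyperplane
    a x = 0; composing N and c with it yields a system without the row a that
    satisfies the hypothesis again, and the induction hypothesis supplies the
    multipliers of N.  The multiplier of a is forced, and it is nonnegative
    because c x1 > 0 while N x1 <= 0. *)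
Lemma farkas p n (M : 'M[R]_(p, n)) (c : 'rV[R]_n) :
  (forall x : 'cV[R]_n, mx_le (M *m x) 0 -> dot c x <= 0) ->
  exists2 y : 'rV[R]_p, mx_le 0 y & y *m M = c.
Proof.
elim: p M c => [|p IH] M c Hc.
  exists 0; first by move=> ? [].
  rewrite mul0mx; apply/esym/rowP => j; rewrite mxE; apply/eqP.
  (* Without rows, c is nonpositive at both a basis vector and its opposite. *)
  have E : dot c (delta_mx j 0) = c 0 j by rewrite /dot -colE mxE.
  have [le0 ge0] : c 0 j <= 0 /\ - c 0 j <= 0.
    by rewrite -E -dotNr; split; apply: Hc => -[].
  by rewrite eq_le le0 -oppr_le0.
move: M Hc; rewrite -[p.+1]/(1 + p)%N => M.
rewrite -[M]vsubmxK; move: (usubmx M) (dsubmx M) => a N {M} Hc.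
have [HN|] := pselect (forall x, mx_le (N *m x) 0 -> dot c x <= 0).
  have [y y0 yN] := IH _ _ HN; exists (row_mx 0 y).
    by apply/mx_le0_row_mx; split.
  by rewrite mul_row_col mul0mx add0r.
move=> /existsNP[x0 /not_implyP[Nx0 /negP]]; rewrite -ltNge => cx0.
have ax0 : 0 < dot a x0.
  rewrite ltNge; apply/negP => ax0.
  suff : dot c x0 <= 0 by rewrite leNgt cx0.
  apply: Hc; rewrite mul_col_mx; apply/mx_le_col_mx0; split=> //.
  by move=> i j; rewrite !ord1 [leRHS]mxE.
pose x1 := (dot a x0)^-1 *: x0.
have Nx1 : mx_le (N *m x1) 0.
  by rewrite -scalemxAr -(scaler0 _ (dot a x0)^-1); apply: mx_leZ Nx0; rewrite invr_ge0 ltW.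
have cx1 : 0 <= dot c x1 by rewrite dotZr ltW // mulr_gt0 // invr_gt0.
have ax1 : a *m x1 = 1%:M.
  apply/matrixP => i j; rewrite !ord1 [LHS]dotZr mulVf ?gt_eqF // mxE //.
(* N and c, precomposed with x |-> x - x1 (a x). *)
have [x Nx|y y0 yN] := IH (N - N *m x1 *m a) (c - c *m x1 *m a).
  have -> : dot (c - c *m x1 *m a) x = dot c (x - x1 *m a *m x).
    by rewrite /dot mulmxBl mulmxBr !mulmxA.
  apply: Hc; rewrite mul_col_mx; apply/mx_le_col_mx0; split.
    by rewrite mulmxBr !mulmxA ax1 mul1mx subrr => i j.
  by rewrite mulmxBr !mulmxA -mulmxBl.
(* The first multiplier is read off by expanding yN. *)
exists (row_mx (c *m x1 - y *m N *m x1) y).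
  apply/mx_le0_row_mx; split=> // i j.
  rewrite !ord1 [leRHS]mxE mxE [X in _ + X]mxE subr_ge0.
  apply: le_trans (_ : 0 <= _) => //.
  by rewrite -mulmxA; have := ler_dot y0 Nx1; rewrite /dot mulmx0 [leRHS]mxE.
rewrite mul_row_col mulmxBl -addrA [X in _ + X]addrC -mulmxA -mulmxA.
by move: yN; rewrite mulmxBr !mulmxA => ->; rewrite addrC subrK.
Qed.

(** Homogenize: if M x <= b is infeasible, then M z <= s b forces s <= 0, since
    otherwise z / s would be a solution.  Farkas' lemma for the functional
    (z, s) |-> s gives y M = 0 and y b = -1. *)
Lemma gale p n (M : 'M[R]_(p, n)) (b : 'cV[R]_p) :
  (forall x : 'cV[R]_n, ~ mx_le (M *m x) b) ->
  exists y : 'rV[R]_p, [/\ mx_le 0 y, y *m M = 0 & dot y b < 0].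
Proof.
move=> infeasible.
have [x|y y0] := @farkas _ _ (row_mx M (- b)) (row_mx 0 1%:M).
  rewrite -[x]vsubmxK; move: (usubmx x) (dsubmx x) => z s {x}.
  rewrite mul_row_col dot_row_col dot0l add0r /dot mul1mx [s]mx11_scalar.
  rewrite mul_mx_scalar scalerN mxE eqxx mulr1n => /mx_leB0 zs.
  rewrite leNgt; apply/negP => s0; apply: (infeasible ((s 0 0)^-1 *: z)).
  exact: mx_le_scale zs.
rewrite mul_mx_row => /eq_row_mx[yM yb]; exists y; split=> //.
by rewrite -[dot y b]opprK -dotNr /dot yb mxE oppr_lt0 ltr01.
Qed.

(** Homogenize: M z <= t b and t >= 0 imply c z <= t delta, which is the
    hypothesis at z / t when t > 0; when t = 0, z is a recession direction, and
    c z > 0 would make c unbounded along x0 + e z.  Farkas' lemma then gives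
    y M = c and y b + t = delta, where t >= 0 is the multiplier of the
    inequality t >= 0. *)
Lemma affine_farkas p n (M : 'M[R]_(p, n)) (b : 'cV[R]_p) (c : 'rV[R]_n)
    (delta : R) (x0 : 'cV[R]_n) :
  mx_le (M *m x0) b ->
  (forall x, mx_le (M *m x) b -> dot c x <= delta) ->
  exists y : 'rV[R]_p, [/\ mx_le 0 y, y *m M = c & dot y b <= delta].
Proof.
move=> Mx0 Hc.
have [x|y] := @farkas _ _ (block_mx M (- b) 0 (-1)%:M) (row_mx c (- delta)%:M).
  rewrite -[x]vsubmxK; move: (usubmx x) (dsubmx x) => z s {x}.
  rewrite [s]mx11_scalar; move: (s 0 0) => t {s}.
  rewrite mul_block_col => /mx_le_col_mx0[].
  rewrite dot_row_col mul_mx_scalar scalerN => /mx_leB0 Mz.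
  rewrite mul0mx add0r -scalar_mxM => /(_ 0 0).
  rewrite scalar11 [leRHS]mxE dot_scalar mulN1r mulNr oppr_le0 subr_le0.
  rewrite le_eqVlt => /predU1P[t0|t0].
    rewrite -t0 mulr0 leNgt; apply/negP => cz.
    (* This step length makes c (x0 + e z) equal to delta + 1. *)
    pose e := (delta - dot c x0 + 1) / dot c z.
    have e0 : 0 <= e.
      by apply: divr_ge0 (ltW cz); have := Hc _ Mx0; lra.
    have /Hc : mx_le (M *m (x0 + e *: z)) b.
      rewrite mulmxDr -scalemxAr => i j.
      have Mzij : (M *m z) i j <= 0.
        by have := Mz i j; rewrite -t0 scale0r [leRHS]mxE.
      rewrite [leLHS]mxE [X in _ + X]mxE -[leRHS]addr0.
      by rewrite lerD ?mulr_ge0_le0.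
    by rewrite dotDr dotZr divfK ?gt_eqF //; lra.
  have /Hc := mx_le_scale t0 Mz.
  by rewrite dotZr ler_pdivrMl // mulrC.
rewrite -[y]hsubmxK; move: (lsubmx y) (rsubmx y) => {y} y t.
move=> /mx_le0_row_mx[y0 t0].
rewrite mul_row_block mulmx0 addr0 => /eq_row_mx[yM].
move=> /(congr1 (fun X : 'M_1 => X 0 0)); rewrite mul_mx_scalar.
rewrite scaleN1r mxE [X in _ + X]mxE scalar11 -/(dot y _) dotNr => E.
by exists y; split=> //; have := t0 0 0; rewrite mxE; lra.
Qed.

Lemma weak_duality p n (M : 'M[R]_(p, n)) (b : 'cV[R]_p) (c : 'rV[R]_n) x y :
  mx_le (M *m x) b -> mx_le 0 y -> y *m M = c -> dot c x <= dot y b.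
Proof. by move=> Mx y0 <-; rewrite dot_mulmx; apply: ler_dot. Qed.

(** Let sup S be the supremum of the objective.  [affine_farkas] yields a dual
    solution y of value at most sup S.  If no feasible x reached sup S, the
    system M x <= b, c x >= sup S would be infeasible, and [gale] would give
    z, t >= 0 with z M = t c and z b < t sup S.  For t = 0 this contradicts the
    feasibility of M x <= b; for t > 0, z / t is a dual solution of value below
    sup S, against weak duality. *)
Lemma strong_duality p n (M : 'M[R]_(p, n)) (b : 'cV[R]_p) (c : 'rV[R]_n)
    (x0 : 'cV[R]_n) (B : R) :
  mx_le (M *m x0) b ->
  (forall x, mx_le (M *m x) b -> dot c x <= B) ->
  exists (x : 'cV[R]_n) (y : 'rV[R]_p),
    [/\ mx_le (M *m x) b, mx_le 0 y, y *m M = c & dot y b = dot c x].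
Proof.
move=> Mx0 HB.
pose S : set R := [set dot c x | x in [set x | mx_le (M *m x) b]].
have supS : has_sup S.
  split; first by exists (dot c x0), x0.
  by exists B => _ [x Mx <-]; apply: HB.
have S_le x : mx_le (M *m x) b -> dot c x <= sup S.
  by move=> Mx; apply: ub_le_sup; [exact: supS.2 | exists x].
have [y [y0 yM yb]] := affine_farkas Mx0 S_le.
have le_sup y' : mx_le 0 y' -> y' *m M = c -> sup S <= dot y' b.
  move=> y'0 y'M; apply: ge_sup; [exact: supS.1 | move=> _ [x Mx <-]].
  exact: weak_duality y'0 y'M.
suff [x Mx cx] : exists2 x, mx_le (M *m x) b & sup S <= dot c x.
  exists x, y; split=> //; apply: le_anti.
  by rewrite (weak_duality Mx y0 yM) (le_trans yb cx).
apply: contrapT => Hno.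
have [x|z [z0 zM zb]] := @gale _ _ (col_mx M (- c)) (col_mx b (- sup S)%:M).
  rewrite mul_col_mx => /mx_le_col_mx[Mx /(_ 0 0)].
  rewrite scalar11 -/(dot _ _) dotNl lerN2 => cx; apply: Hno.
  by exists x.
move: z0 zM zb; rewrite -[z]hsubmxK; move: (lsubmx z) (rsubmx z) => {z} z t.
move=> /mx_le0_row_mx[z0 /(_ 0 0)].
rewrite mul_row_col dot_row_col [t]mx11_scalar mul_scalar_mx scalerN.
rewrite dot_scalar scalar11 [leLHS]mxE; move: (t 0 0) => {}t.
move=> t0 /subr0_eq zM zb; move: t0; rewrite le_eqVlt => /predU1P[t0|t0].
  have := weak_duality Mx0 z0 zM; rewrite -t0 scale0r dot0l leNgt.
  by move: zb; rewrite -t0 mul0r addr0 => ->.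
have := le_sup (t^-1 *: z); rewrite -scalemxAl zM scalerK ?gt_eqF // => H.
have /H /(_ erefl) : mx_le 0 (t^-1 *: z).
  by rewrite -(scaler0 _ t^-1); apply: mx_leZ z0; rewrite invr_ge0 ltW.
by rewrite dotZl ler_pdivlMl //; move: zb; lra.
Qed.

End LinearProgramming.

(** * Optimal values, linear spans and rank *)

Section Values.
Variable R : realType.

Lemma max_value_ge (T : Type) (S : set T) (f : T -> R) x :
  S x -> ((f x)%:E <= max_value S f)%E.
Proof. by move=> Sx; apply: ereal_sup_ubound; exists x. Qed.

Lemma max_value_le (T : Type) (S : set T) (f : T -> R) (B : \bar R) :
  (forall x, S x -> ((f x)%:E <= B)%E) -> (max_value S f <= B)%E.
Proof. by move=> SB; apply: ge_ereal_sup => _ [x Sx <-]; apply: SB. Qed.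

Lemma max_value_maximizer (T : Type) (S : set T) (f : T -> R) x :
  is_maximizer S f x -> max_value S f = (f x)%:E.
Proof.
move=> [Sx maxx]; apply/le_anti; rewrite max_value_ge // andbT.
by apply: max_value_le => y Sy; rewrite lee_fin maxx.
Qed.

Lemma linear_span_sub n (S : set 'cV[R]_n) x : S x -> linear_span S x.
Proof.
move=> Sx; exists [:: x]; first by move=> y; rewrite inE => /eqP ->.
by rewrite memv_span ?inE.
Qed.

Lemma linear_span_mulmx n r (S : set 'cV[R]_n) (V : 'M[R]_(n, r))
    (lambda : 'cV[R]_r) :
  (forall j, linear_span S (col j V)) -> linear_span S (V *m lambda).
Proof.
move=> SV; have -> : V *m lambda = \sum_j lambda j 0 *: col j V.
  apply/colP => i; rewrite !mxE summxE; apply: eq_bigr => j _.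
  by rewrite !mxE mulrC.
apply: big_ind => [|x y [X SX xX] [Y SY yY]|j _].
- by exists [::] => //; rewrite mem0v.
- exists (X ++ Y); last by rewrite span_cat memv_add.
  by move=> z; rewrite mem_cat => /orP[/SX | /SY].
- by have [X SX xX] := SV j; exists X; rewrite ?memvZ.
Qed.

(** Binary vectors are the images of the finite functions 'I_n -> bool, over
    which a maximum is attained. *)
Lemma binary_maximizer n (S : set 'cV[R]_n) (f : 'cV[R]_n -> R) :
  (forall z, S z -> binary z) -> S !=set0 -> exists v, is_maximizer S f v.
Proof.
move=> Sbin [z0 Sz0].
pose vec (e : {ffun 'I_n -> bool}) : 'cV[R]_n := \col_i (e i)%:R.
have vecP z : S z -> exists e, z = vec e.
  move=> /Sbin zbin; exists [ffun i => z i 0 == 1].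
  apply/colP => i; rewrite mxE ffunE.
  by case: (zbin i) => ->; rewrite ?eqxx // eq_sym oner_eq0.
have [e0 z0E] := vecP _ Sz0.
have Se0 : `[< S (vec e0) >] by apply/asboolP; rewrite -z0E.
pose inS e := `[< S (vec e) >].
case: (@arg_maxP _ _ _ e0 inS (fun e => f (vec e)) Se0) => e /asboolP Se maxe.
exists (vec e); split=> // z Sz; have [e' E] := vecP _ Sz.
by rewrite E; apply: maxe; apply/asboolP; rewrite -E.
Qed.

Lemma ltn_rank_row_mx n r (V : 'M[R]_(n, r)) (v : 'cV[R]_n) :
  (forall mu, v <> V *m mu) -> (\rank V < \rank (row_mx V v))%N.
Proof.
move=> vV; rewrite -mxrank_tr -(mxrank_tr (row_mx V v)) tr_row_mx.
apply: (rank_ltmx (_ : _ < _)%MS); rewrite ltmxE -addsmxE addsmxSl /=.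
rewrite col_mx_sub submx_refl /=; apply/negP => /submxP[w vE].
by apply: (vV w^T); rewrite -[LHS]trmxK vE trmx_mul trmxK.
Qed.

End Values.

(** * The restricted master problem *)

Section GCG.
Variables (R : realType) (n m p q : nat) (D : gcg_data R n m p q).

Section Master.
Variables (r : nat) (V : 'M[R]_(n, r)).

(** The master problem as the linear program max cd x, M x <= bh, in the single
    unknown x = col_mx lambda u. *)
Let M : 'M[R]_(p + q, r + m) := block_mx (gA D *m V) 0 (gH D *m V) (gG D).
Let bh : 'cV[R]_(p + q) := col_mx (gb D) (gh D).
Let cd : 'rV[R]_(r + m) := row_mx ((gc D)^T *m V) (gd D)^T.

Let master_feasibleE lu :
  master_feasible D V lu <-> mx_le (M *m col_mx lu.1 lu.2) bh.
Proof. by rewrite mul_block_col mul0mx addr0 mx_le_col_mx. Qed.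

Let master_dual_feasibleE ap :
  master_dual_feasible D V ap <->
  mx_le 0 (row_mx ap.1 ap.2) /\ row_mx ap.1 ap.2 *m M = cd.
Proof.
rewrite mul_row_block mulmx0 add0r !mulmxA mx_le0_row_mx.
split=> [[al0 pi0 -> ->] // | [[al0 pi0] /eq_row_mx[E1 E2]]]; by split.
Qed.

Let master_objectiveE lu : master_objective D V lu = dot cd (col_mx lu.1 lu.2).
Proof. by rewrite dot_row_col. Qed.

Let master_dual_objectiveE ap :
  master_dual_objective D ap = dot (row_mx ap.1 ap.2) bh.
Proof. by rewrite dot_row_col. Qed.

Lemma master_weak_duality lu ap :
  master_feasible D V lu -> master_dual_feasible D V ap ->
  master_objective D V lu <= master_dual_objective D ap.
Proof.
move=> /master_feasibleE Mlu /master_dual_feasibleE[ap0 apM].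
by rewrite master_objectiveE master_dual_objectiveE; apply: weak_duality apM.
Qed.

Lemma master_strong_duality lu0 (B : R) :
  master_feasible D V lu0 ->
  (forall lu, master_feasible D V lu -> master_objective D V lu <= B) ->
  exists lu ap, [/\ master_feasible D V lu, master_dual_feasible D V ap
    & master_dual_objective D ap = master_objective D V lu].
Proof.
move=> /master_feasibleE Mlu0 HB.
have [x|x [y [Mx y0 yM E]]] := strong_duality Mlu0 (c := cd) (B := B).
  rewrite -[x]vsubmxK => Mx.
  have /HB : master_feasible D V (usubmx x, dsubmx x) by apply/master_feasibleE.
  by rewrite master_objectiveE.
exists (usubmx x, dsubmx x), (lsubmx y, rsubmx y); split.
- by apply/master_feasibleE; rewrite vsubmxK.
- by apply/master_dual_feasibleE; rewrite hsubmxK.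
- by rewrite master_objectiveE master_dual_objectiveE vsubmxK hsubmxK.
Qed.

Lemma master_solution_exists lu0 (B : R) :
  master_feasible D V lu0 ->
  (forall lu, master_feasible D V lu -> master_objective D V lu <= B) ->
  exists lambda u alpha pi, master_solution D V lambda u alpha pi.
Proof.
move=> Flu0 HB.
have [[lambda u] [[alpha pi] [Flu Fap E]]] := master_strong_duality Flu0 HB.
exists lambda, u, alpha, pi; split; split=> // y Fy.
  by rewrite -E master_weak_duality.
by rewrite E master_weak_duality.
Qed.

Lemma master_value_dual lambda u alpha pi :
  master_solution D V lambda u alpha pi ->
  master_value D V = (master_dual_objective D (alpha, pi))%:E.
Proof.
move=> [maxlu minap]; rewrite /master_value (max_value_maximizer maxlu).
have [lu [ap [Flu Fap E]]] := master_strong_duality maxlu.1 maxlu.2.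
congr EFin; apply/le_anti; rewrite (master_weak_duality maxlu.1 minap.1) /=.
by apply: le_trans (minap.2 _ Fap) _; rewrite E maxlu.2.
Qed.

(** If the column priced lies in the span of V already, the dual equation
    replaces c' V mu by alpha A V mu + pi H V mu; the terms in H cancel, and
    what remains is at most the dual objective. *)
Lemma pricing_objective_span lambda u alpha pi mu :
  master_solution D V lambda u alpha pi -> gcgP D (V *m mu) ->
  ((pricing_objective D pi (V *m mu))%:E <= master_value D V)%E.
Proof.
move=> sol [_ AVmu]; rewrite (master_value_dual sol) lee_fin.
have [_ [[al0 _ /= eqV _] _]] := sol.
have cVmu : dot (gc D)^T (V *m mu) =
    dot alpha (gA D *m (V *m mu)) + dot pi (gH D *m (V *m mu)).
  by rewrite -dot_mulmx -eqV dotDl !dot_mulmx.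
rewrite /pricing_objective cVmu dotDr dotNr opprD opprK addrA addrK.
by rewrite /master_dual_objective lerD2r /= ler_dot.
Qed.

Lemma lin_feasible_master :
  (forall j, linear_span (gcgP D) (col j V)) -> forall lu,
  master_feasible D V lu -> lin_feasible D (V *m lu.1, lu.2).
Proof.
move=> spanV lu [Alu Hlu]; split; rewrite /= ?mulmxA //.
exact: linear_span_mulmx.
Qed.

Lemma master_feasible_lin lambda u :
  lin_feasible D (V *m lambda, u) -> master_feasible D V (lambda, u).
Proof. by case; rewrite /= !mulmxA. Qed.

Lemma master_objectiveE_lin lu :
  master_objective D V lu = objective D (V *m lu.1, lu.2).
Proof. by rewrite /master_objective dot_mulmx. Qed.

Lemma master_value_le_Z_LIN :
  (forall j, linear_span (gcgP D) (col j V)) -> (master_value D V <= Z_LIN D)%E.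
Proof.
move=> spanV; apply: max_value_le => lu Flu; rewrite master_objectiveE_lin.
exact/max_value_ge/lin_feasible_master.
Qed.

End Master.

(** * The bounds and the termination of the algorithm *)

(** Lagrangian relaxation of the constraints H z + G u <= h.  The free variable
    u drops out because pi G = d'. *)
Lemma Z_IP_le_pricing_value (pi : 'rV[R]_q) :
  mx_le 0 pi -> pi *m gG D = (gd D)^T -> (Z_IP D <= pricing_value D pi)%E.
Proof.
move=> pi0 piG; apply: max_value_le => -[z u] [Az Hz zbin].
apply: le_trans (max_value_ge (x := z) _ _); last by split.
rewrite lee_fin /objective /pricing_objective /= lerD2l -piG dot_mulmx.
have := ler_dot pi0 Hz; rewrite /= !dotDr dotNr; lra.
Qed.

Lemma upper_bound_rcons pis (pi : 'rV[R]_q) :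
  upper_bound D (rcons pis pi) = mine (upper_bound D pis) (pricing_value D pi).
Proof.
rewrite /upper_bound; elim: pis => [|pi' pis IH] /=.
  by rewrite big_cons !big_nil minC.
by rewrite !big_cons IH minA.
Qed.

(** The existence of a feasible point of the column span is what keeps the
    master problem feasible; the last clause for a running state is the lower
    bound that is handed over to the returned value. *)
Definition gcg_invariant (s : gcg_state R n q) : Prop :=
  match s with
  | Running _ V pis =>
      [/\ forall j, linear_span (gcgP D) (col j V),
          exists lambda u, lin_feasible D (V *m lambda, u)
        & (Z_IP D <= upper_bound D pis)%E]
  | Returned z => (Z_IP D <= z)%E /\ (z <= Z_LIN D)%E
  end.

Lemma gcg_step_invariant s t :
  gcg_step D s t -> gcg_invariant s -> gcg_invariant t.
Proof.
have bound r (V : 'M_(n, r)) pis lambda u alpha pi :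
    master_solution D V lambda u alpha pi -> (Z_IP D <= upper_bound D pis)%E ->
    (Z_IP D <= upper_bound D (rcons pis pi))%E.
  move=> [_ [[_ pi0 _ piG] _]] Zpis.
  by rewrite upper_bound_rcons le_min Zpis Z_IP_le_pricing_value.
case=> r V pis lambda u alpha pi v sol [Pv _] stop [spanV [mu [w feas]] Zpis].
  split; first exact: bound sol Zpis.
  exact: le_trans stop (master_value_le_Z_LIN spanV).
split; last exact: bound sol Zpis.
- move=> j; rewrite -(splitK j); case: (split j) => j' /=.
    by rewrite colKl.
  by rewrite colKr col_id; apply: linear_span_sub.
(* The new column gets weight 0 in the old feasible point. *)
- by exists (col_mx mu 0), w; rewrite mul_row_col mulmx0 addr0.
Qed.

Definition gcg_progress (s t : gcg_state R n q) : Prop :=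
  match s, t with
  | Running _ V _, Running _ W _ => (\rank V < \rank W)%N
  | Running _ _ _, Returned _ => True
  | Returned _, _ => False
  end.

(** Were the appended column in the span of V, [pricing_objective_span] would
    give L(pi) <= Z(V), and the algorithm would have stopped. *)
Lemma gcg_step_progress s t : gcg_step D s t -> gcg_progress s t.
Proof.
case=> //= r V pis lambda u alpha pi v sol maxv nstop.
apply: ltn_rank_row_mx => mu vE; apply: nstop; rewrite upper_bound_rcons.
rewrite ge_min; apply/orP; right.
rewrite /pricing_value (max_value_maximizer maxv) vE.
by apply: pricing_objective_span sol _; rewrite -vE; case: maxv.
Qed.

Lemma gcg_step_exists r (V : 'M[R]_(n, r)) pis :
  gcgP D !=set0 -> Z_LIN D \is a fin_num -> gcg_invariant (Running V pis) ->
  exists s, gcg_step D (Running V pis) s.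
Proof.
move=> P0 finLIN [spanV [mu [w feas]] _].
have [lu Flu|lambda [u [alpha [pi sol]]]] :=
  master_solution_exists (B := fine (Z_LIN D)) (master_feasible_lin feas).
  rewrite -lee_fin fineK // master_objectiveE_lin.
  exact/max_value_ge/lin_feasible_master.
have [v maxv] : exists v, is_maximizer (gcgP D) (pricing_objective D pi) v.
  by apply: binary_maximizer => // z [].
have [stop|nstop] := pselect (upper_bound D (rcons pis pi) <= master_value D V)%E.
  by exists (Returned (upper_bound D (rcons pis pi))); apply: gcg_stop sol maxv stop.
by exists (Running (row_mx V v) (rcons pis pi)); apply: gcg_continue sol maxv nstop.
Qed.

(** Along an infinite execution the k-th matrix has n rows and rank at least k,
    which is absurd for k = n + 1. *)
Lemma gcg_terminates (s : nat -> gcg_state R n q) :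
  ~ forall k, gcg_step D (s k) (s k.+1).
Proof.
move=> steps; have prog k := gcg_step_progress (steps k).
have rank_ge k :
    exists r (V : 'M_(n, r)) pis, s k = Running V pis /\ (k <= \rank V)%N.
  elim: k => [|k [r [V [pis [sk kV]]]]].
    by move: (prog 0); case: (s 0) => [r V pis|//] _; exists r, V, pis.
  move: (prog k) (prog k.+1); rewrite sk.
  case: (s k.+1) => [r' V' pis'|//] /= VV' _.
  by exists r', V', pis'; split=> //; apply: leq_trans VV'.
have [r [V [_ [_]]]] := rank_ge n.+1.
by rewrite ltnNge rank_leq_row.
Qed.

End GCG.

Theorem mainTheorem2 (R : realType) (n m p q : nat) (D : gcg_data R n m p q)
    (r : nat) (V1 : 'M[R]_(n, r))
    (Hbounds : includes_unit_bounds D)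
    (HP : gcgP D !=set0)
    (Hfeasible : lin_feasible D !=set0)
    (Hfinite : Z_LIN D \is a fin_num)
    (HV1 : initial_matrix D V1) :
  (* no execution gets stuck before returning *)
  (forall (k : nat) (V : 'M[R]_(n, k)) (pis : seq 'rV[R]_q),
     gcg_reachable D (Running V1 [::]) (Running V pis) ->
     exists s, gcg_step D (Running V pis) s) /\
  (* no execution runs forever *)
  (~ exists s : nat -> gcg_state R n q,
       s 0%N = Running V1 [::] /\ forall k, gcg_step D (s k) (s k.+1)) /\
  (* every value that an execution returns satisfies the bounds *)
  (forall ZUB : \bar R,
     gcg_reachable D (Running V1 [::]) (Returned ZUB) ->
     (Z_IP D <= ZUB)%E /\ (ZUB <= Z_LIN D)%E).
Proof.
have inv s : gcg_reachable D (Running V1 [::]) s -> gcg_invariant D s.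
  elim=> [|t t' step _]; last exact: gcg_step_invariant step.
  have [_ spanV1 feasV1] := HV1; split=> //.
  by rewrite /upper_bound big_nil leey.
split; [|split].
- by move=> k V pis /inv; apply: gcg_step_exists.
- by move=> [s [_ /gcg_terminates]].
- by move=> ZUB /inv.
Qed.
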